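(* Let $L$ be an $n$-Lie algebra over a field. Then $L$ is $2$-capable if and only if $Z_2^*(L)=0$.
   Context: An $n$-Lie algebra ($n\ge 2$) is a vector space $L$ over a field with a multilinear skew-symmetric operation $[x_1,\ldots,x_n]$ satisfying $[[x_1,\ldots,x_n],y_2,\ldots,y_n]=\sum_{i=1}^n[x_1,\ldots,[x_i,y_2,\ldots,y_n],\ldots,x_n]$. An ideal is a subspace $I$ with $[I,L,\dots,L]\subseteq I$. The center is $Z(L)=\{z\in L: [z,L,\dots,L]=0\}$; the upper central series is $Z_0(L)=0$, $Z_1(L)=Z(L)$, $Z_i(L)/Z_{i-1}(L)=Z(L/Z_{i-1}(L))$. $L$ is $c$-capable if there is an $n$-Lie algebra $H$ with $L\cong H/Z_c(H)$. $Z_c^*(L)$ is the smallest ideal $M$ of $L$ such that $L/M$ is $c$-capable. *)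

(* Defs.v *)
From HB Require Import structures.
From mathcomp Require Import all_boot all_algebra perm.
From mathcomp Require Import boolp.

Set Implicit Arguments.
Unset Strict Implicit.
Unset Printing Implicit Defensive.

Import GRing.Theory.
Local Open Scope ring_scope.
Local Open Scope quotient_scope.

Definition upd (n : nat) (T : Type) (x : 'I_n -> T) (i : 'I_n) (v : T) : 'I_n -> T :=
  fun j => if j == i then v else x j.

(* In [br_filippov], [i0] is the first argument slot: [upd y i0 u] is
   (u, y_2, ..., y_n), the entry [y i0] being discarded.  The bound [2 <= n]
   is not built in; it is assumed where the structure is used. *)
HB.mixin Record isNLieAlgebra (K : fieldType) (n : nat) L of GRing.Lmodule K L := {
  br : ('I_n -> L) -> L;
  br_linear : forall (x : 'I_n -> L) (i : 'I_n), linear (fun v => br (upd x i v));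
  br_skew : forall (s : 'S_n) (x : 'I_n -> L), br (x \o s) = (-1) ^+ s *: br x;
  br_filippov : forall i0 : 'I_n, i0 = 0%N :> nat -> forall x y : 'I_n -> L,
    br (upd y i0 (br x)) = \sum_(i < n) br (upd x i (br (upd y i0 (x i))))
}.

#[short(type="nLieType")]
HB.structure Definition NLieAlgebra (K : fieldType) (n : nat) :=
  {L of isNLieAlgebra K n L & GRing.Lmodule K L}.

Record nideal (K : fieldType) (n : nat) (L : nLieType K n) := NIdeal {
  nideal_pred :> {pred L};
  nideal_submod : submod_closed nideal_pred;
  nideal_br : forall i0 : 'I_n, i0 = 0%N :> nat ->
    forall x : 'I_n -> L, x i0 \in nideal_pred -> br x \in nideal_pred
}.

Section Slots.
Variables (n : nat) (T U : Type).
Implicit Types (x : 'I_n -> T) (f : T -> U).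

Lemma upd_id x i : upd x i (x i) = x.
Proof. by apply: funext => j; rewrite /upd; case: eqP => // ->. Qed.

Lemma upd_eq x i v : upd x i v i = v.
Proof. by rewrite /upd eqxx. Qed.

Lemma upd_comp f x i v : f \o upd x i v = upd (f \o x) i (f v).
Proof. by apply: funext => j; rewrite /upd /=; case: eqP. Qed.

End Slots.

Section Quotient.
Variables (K : fieldType) (n : nat) (L : nLieType K n) (I : nideal L).
Implicit Types x y : 'I_n -> L.

HB.instance Definition _ :=
  GRing.isSubmodClosed.Build K L (nideal_pred I) (nideal_submod I).

Lemma nideal_br_slot i x : x i \in nideal_pred I -> br x \in nideal_pred I.
Proof.
move=> xi; have n0 : (0 < n)%N by apply: leq_ltn_trans (ltn_ord i).
pose i0 := Ordinal n0; pose s := tperm i0 i.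
have -> : x = (x \o s) \o s by apply: funext => j /=; rewrite tpermK.
rewrite br_skew; apply: rpredZ; apply: (@nideal_br _ _ _ I i0) => [|/=]; first by [].
by rewrite tpermL.
Qed.

Lemma nideal_br_congr x y :
  (forall i, x i - y i \in nideal_pred I) -> br x - br y \in nideal_pred I.
Proof.
move=> xy; pose z k : 'I_n -> L := fun j => if (j < k)%N then y j else x j.
suff H k : (k <= n)%N -> br x - br (z k) \in nideal_pred I.
  have -> : y = z n by apply: funext => j; rewrite /z ltn_ord.
  exact: H.
elim: k => [_|k IH kn].
  by have -> : z 0%N = x by []; rewrite subrr rpred0.
pose i := Ordinal kn.
have zk : z k = upd (z k) i (x i).
  by apply: funext => j; rewrite /upd /z; case: eqP => // ->; rewrite ltnn.
have zk1 : z k.+1 = upd (z k) i (y i).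
  apply: funext => j; rewrite /upd /z ltnS leq_eqVlt.
  by rewrite -[j == i]/(j == k :> nat); case: eqP => //= e; congr y; apply: val_inj.
have -> : br x - br (z k.+1) =
    (br x - br (z k)) + br (upd (z k) i (-1 *: y i + x i)).
  by rewrite br_linear -zk -zk1 scaleN1r [- _ + _]addrC addrA subrK.
by apply: rpredD; [exact: IH (ltnW kn)|apply: (@nideal_br_slot i); rewrite upd_eq scaleN1r addrC].
Qed.

Definition nquot : Type := {ideal_quot (nideal_pred I)}.

HB.instance Definition _ := GRing.Zmodule.on nquot.

Definition npi (x : L) : nquot := \pi_{ideal_quot (nideal_pred I)} x.
Definition nrepr (q : nquot) : L := repr q.

Lemma nreprK : cancel nrepr npi.
Proof. exact: reprK. Qed.

Lemma npi_eq u v : npi u = npi v <-> u - v \in nideal_pred I.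
Proof. by rewrite Quotient.idealrBE; split=> [/eqP|/eqP]. Qed.

Lemma nrepr_pi u : u - nrepr (npi u) \in nideal_pred I.
Proof. by apply/npi_eq; rewrite nreprK. Qed.

Lemma npiD : {morph npi : u v / u + v}.
Proof. exact: raddfD. Qed.

Definition nquot_scale (a : K) (q : nquot) : nquot := npi (a *: nrepr q).

Lemma npiZ a u : npi (a *: u) = nquot_scale a (npi u).
Proof. by apply/npi_eq; rewrite -scalerBr rpredZ // nrepr_pi. Qed.

Fact nquot_scalerA a b q :
  nquot_scale a (nquot_scale b q) = nquot_scale (a * b) q.
Proof. by rewrite -[q]nreprK -!npiZ scalerA. Qed.

Fact nquot_scale1r : left_id 1 nquot_scale.
Proof. by move=> q; rewrite -[q]nreprK -npiZ scale1r. Qed.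

Fact nquot_scalerDr : right_distributive nquot_scale +%R.
Proof.
move=> a p q; rewrite -[p]nreprK -[q]nreprK -npiD -!npiZ -npiD.
by rewrite scalerDr.
Qed.

Fact nquot_scalerDl q : {morph nquot_scale^~ q : a b / a + b}.
Proof. by move=> a b; rewrite -[q]nreprK -!npiZ -npiD scalerDl. Qed.

HB.instance Definition _ := GRing.Zmodule_isLmodule.Build K nquot
  nquot_scalerA nquot_scale1r nquot_scalerDr nquot_scalerDl.

Fact npi_linear : linear npi.
Proof. by move=> a u v; rewrite npiD npiZ. Qed.

HB.instance Definition _ := GRing.isLinear.Build K L nquot _ npi npi_linear.

Lemma npi_eq0 u : npi u = 0 <-> u \in nideal_pred I.
Proof. by rewrite -(raddf0 npi) npi_eq subr0. Qed.

Definition nquot_br (q : 'I_n -> nquot) : nquot := npi (br (nrepr \o q)).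

Lemma npi_br x : npi (br x) = nquot_br (npi \o x).
Proof. by apply/npi_eq/nideal_br_congr => i; apply: nrepr_pi. Qed.

Lemma nquot_lift (q : 'I_n -> nquot) : q = npi \o (nrepr \o q).
Proof. by apply: funext => i /=; rewrite nreprK. Qed.

Lemma npi_br_upd x i u : npi (br (upd x i u)) = nquot_br (upd (npi \o x) i (npi u)).
Proof. by rewrite npi_br upd_comp. Qed.

Fact nquot_br_linear (q : 'I_n -> nquot) i :
  linear (fun v => nquot_br (upd q i v)).
Proof.
move=> a u v; rewrite (nquot_lift q) -[u]nreprK -[v]nreprK -npi_linear.
by rewrite -!npi_br_upd br_linear npi_linear.
Qed.

Fact nquot_br_skew (s : 'S_n) (q : 'I_n -> nquot) :
  nquot_br (q \o s) = (-1) ^+ s *: nquot_br q.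
Proof.
rewrite (nquot_lift q); set x := nrepr \o q.
by rewrite -[_ \o s]/(npi \o (x \o s)) -!npi_br br_skew npiZ.
Qed.

Fact nquot_br_filippov (i0 : 'I_n) : i0 = 0%N :> nat ->
  forall p q : 'I_n -> nquot,
  nquot_br (upd q i0 (nquot_br p)) =
    \sum_(i < n) nquot_br (upd p i (nquot_br (upd q i0 (p i)))).
Proof.
move=> hi0 p q; rewrite (nquot_lift q) (nquot_lift p).
rewrite -npi_br -npi_br_upd br_filippov // raddf_sum.
by apply: eq_bigr => i _; rewrite [in RHS]/= -!npi_br_upd.
Qed.

HB.instance Definition _ := isNLieAlgebra.Build K n nquot
  nquot_br_linear nquot_br_skew nquot_br_filippov.

End Quotient.

Section Series.
Variables (K : fieldType) (n : nat).
Implicit Type L : nLieType K n.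

Lemma br0 L (x : 'I_n -> L) i : x i = 0 -> br x = 0.
Proof.
move=> xi; have := br_linear x i (-1) (x i) (x i).
by rewrite scaleN1r addNr upd_id -[X in upd x i X]xi upd_id scaleN1r addNr.
Qed.

Definition center_pred L : {pred L} := fun z =>
  `[< forall i0 : 'I_n, i0 = 0%N :> nat ->
      forall x : 'I_n -> L, br (upd x i0 z) = 0 >].

Arguments center_pred : clear implicits.

(* The inverse image in [L] of the center of [L / I]. *)
Definition center_over_pred L (I : nideal L) : {pred L} :=
  fun x => npi I x \in center_pred (nquot I).

Lemma center_over_predP L (I : nideal L) x :
  reflect (forall i0 : 'I_n, i0 = 0%N :> nat ->
             forall y : 'I_n -> L, br (upd y i0 x) \in nideal_pred I)
          (x \in center_over_pred I).
Proof.
apply: (iffP (asboolP _)) => h i0 hi0 y.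
  by apply/npi_eq0; rewrite npi_br_upd; apply: h.
by rewrite (nquot_lift y) -[LHS]npi_br_upd; apply/npi_eq0/h.
Qed.

Fact center_over_submod L (I : nideal L) : submod_closed (center_over_pred I).
Proof.
split=> [|a u v /center_over_predP hu /center_over_predP hv];
    apply/center_over_predP => i0 hi0 y.
  by rewrite (@br0 _ _ i0) ?upd_eq // rpred0.
by rewrite br_linear rpredD ?rpredZ ?hu ?hv.
Qed.

Fact center_over_br L (I : nideal L) (i0 : 'I_n) : i0 = 0%N :> nat ->
  forall x : 'I_n -> L,
    x i0 \in center_over_pred I -> br x \in center_over_pred I.
Proof.
move=> hi0 x /center_over_predP h; apply/center_over_predP => j0 hj0 y.
apply: (nideal_br_slot (i := j0)); rewrite upd_eq.
by have := h i0 hi0 x; rewrite upd_id.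
Qed.

Definition center_over L (I : nideal L) : nideal L :=
  NIdeal (center_over_submod I) (@center_over_br L I).

Fact zero_submod L : submod_closed (pred1 (0 : L)).
Proof.
split=> [|a u v /eqP-> /eqP->]; first exact: eqxx.
by rewrite scaler0 addr0; exact: eqxx.
Qed.

Fact zero_br L (i0 : 'I_n) : i0 = 0%N :> nat ->
  forall x : 'I_n -> L, x i0 \in pred1 0 -> br x \in pred1 0.
Proof. by move=> _ x /eqP/br0->; exact: eqxx. Qed.

Definition zero_ideal L : nideal L := NIdeal (@zero_submod L) (@zero_br L).

Fixpoint upper_central L (c : nat) : nideal L :=
  if c is c'.+1 then center_over (upper_central L c') else zero_ideal L.

Definition nlie_iso L1 L2 : Prop :=
  exists f : {linear L1 -> L2},
    bijective f /\ forall x : 'I_n -> L1, f (br x) = br (f \o x).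

Definition capable (c : nat) L : Prop :=
  exists H : nLieType K n, nlie_iso L (nquot (upper_central H c)).

Definition smallest_capable_ideal (c : nat) L (M : nideal L) : Prop :=
  capable c (nquot M) /\
  forall M' : nideal L, capable c (nquot M') -> {subset M <= M'}.

End Series.

(* Direct products of arbitrary families, needed only to prove that a smallest
   ideal with c-capable quotient exists: L / (intersection of the M_i) is a
   pullback of the L / M_i inside the product of the H_i / Z_c(H_i). *)
Section Product.
Variables (K : fieldType) (n : nat) (T : Type) (H : T -> nLieType K n).

Definition nprod : Type := forall t, H t.
Implicit Types (h k : nprod).

HB.instance Definition _ := gen_eqMixin nprod.
HB.instance Definition _ := gen_choiceMixin nprod.

Definition nprod_add h k : nprod := fun t => h t + k t.
Definition nprod_opp h : nprod := fun t => - h t.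
Definition nprod_zero : nprod := fun t => 0.
Definition nprod_scale (a : K) h : nprod := fun t => a *: h t.
Definition nprod_br (x : 'I_n -> nprod) : nprod := fun t => br (fun i => x i t).

Lemma nprodP h k : (forall t, h t = k t) -> h = k.
Proof. exact: functional_extensionality_dep. Qed.

Fact nprod_addA : associative nprod_add.
Proof. by move=> *; apply: nprodP => t; apply: addrA. Qed.
Fact nprod_addC : commutative nprod_add.
Proof. by move=> *; apply: nprodP => t; apply: addrC. Qed.
Fact nprod_add0 : left_id nprod_zero nprod_add.
Proof. by move=> *; apply: nprodP => t; apply: add0r. Qed.
Fact nprod_addN : left_inverse nprod_zero nprod_opp nprod_add.
Proof. by move=> *; apply: nprodP => t; apply: addNr. Qed.

HB.instance Definition _ :=
  GRing.isZmodule.Build nprod nprod_addA nprod_addC nprod_add0 nprod_addN.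

Fact nprod_scaleA a b h : nprod_scale a (nprod_scale b h) = nprod_scale (a * b) h.
Proof. by apply: nprodP => t; apply: scalerA. Qed.
Fact nprod_scale1 : left_id 1 nprod_scale.
Proof. by move=> *; apply: nprodP => t; apply: scale1r. Qed.
Fact nprod_scaleDr : right_distributive nprod_scale +%R.
Proof. by move=> *; apply: nprodP => t; apply: scalerDr. Qed.
Fact nprod_scaleDl h : {morph nprod_scale^~ h : a b / a + b}.
Proof. by move=> *; apply: nprodP => t; apply: scalerDl. Qed.

HB.instance Definition _ := GRing.Zmodule_isLmodule.Build K nprod
  nprod_scaleA nprod_scale1 nprod_scaleDr nprod_scaleDl.

Fact nprod_proj_linear t : linear (fun h : nprod => h t).
Proof. by []. Qed.

Lemma nprod_upd (x : 'I_n -> nprod) i v t :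
  (fun j => upd x i v j t) = upd (fun j => x j t) i (v t).
Proof. by apply: funext => j; rewrite /upd; case: eqP. Qed.

Lemma nprod_sum (F : 'I_n -> nprod) t : (\sum_(i < n) F i) t = \sum_(i < n) F i t.
Proof. by elim/big_rec2: _ => // i y1 y2 _ <-. Qed.

Lemma nprod_br_upd (x : 'I_n -> nprod) i v t :
  nprod_br (upd x i v) t = br (upd (fun j => x j t) i (v t)).
Proof. by rewrite /nprod_br nprod_upd. Qed.

Fact nprod_br_linear (x : 'I_n -> nprod) i : linear (fun v => nprod_br (upd x i v)).
Proof.
move=> a u v; apply: nprodP => t; rewrite nprod_br_upd.
by rewrite [LHS](br_linear (fun j => x j t)) -!nprod_br_upd.
Qed.

Fact nprod_br_skew (s : 'S_n) (x : 'I_n -> nprod) :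
  nprod_br (x \o s) = (-1) ^+ s *: nprod_br x.
Proof. by apply: nprodP => t; apply: (br_skew s (fun j => x j t)). Qed.

Fact nprod_br_filippov (i0 : 'I_n) : i0 = 0%N :> nat ->
  forall x y : 'I_n -> nprod, nprod_br (upd y i0 (nprod_br x)) =
    \sum_(i < n) nprod_br (upd x i (nprod_br (upd y i0 (x i)))).
Proof.
move=> hi0 x y; apply: nprodP => t.
rewrite nprod_sum nprod_br_upd br_filippov //.
by apply: eq_bigr => i _; rewrite !nprod_br_upd.
Qed.

HB.instance Definition _ := isNLieAlgebra.Build K n nprod
  nprod_br_linear nprod_br_skew nprod_br_filippov.

End Product.

Section Subalgebra.
Variables (K : fieldType) (n : nat) (L : nLieType K n) (S : {pred L}).
Hypothesis S_submod : submod_closed S.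
Hypothesis S_br : forall x : 'I_n -> L, (forall i, x i \in S) -> br x \in S.

Definition nsub_of of submod_closed S
    & (forall x : 'I_n -> L, (forall i, x i \in S) -> br x \in S) : Type :=
  {u : L | u \in S}.
Notation W := (nsub_of S_submod S_br).

HB.instance Definition _ := SubChoice.on W.
HB.instance Definition _ := GRing.SubChoice_isSubLmodule.Build K L S W S_submod.

Definition nsub_br (x : 'I_n -> W) : W := Sub (br (val \o x)) (S_br (fun i => valP (x i))).

Lemma val_nsub_br (x : 'I_n -> W) : val (nsub_br x) = br (val \o x).
Proof. by []. Qed.

Lemma val_nsub_upd (x : 'I_n -> W) i v :
  val (nsub_br (upd x i v)) = br (upd (val \o x) i (val v)).
Proof. by rewrite val_nsub_br upd_comp. Qed.

Lemma val_nsubP a (u v : W) : val (a *: u + v) = a *: val u + val v.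
Proof. exact: linearP. Qed.

Fact nsub_br_linear (x : 'I_n -> W) i : linear (fun v => nsub_br (upd x i v)).
Proof.
move=> a u v; apply: val_inj.
by rewrite val_nsubP !val_nsub_upd val_nsubP br_linear.
Qed.

Fact nsub_br_skew (s : 'S_n) (x : 'I_n -> W) :
  nsub_br (x \o s) = (-1) ^+ s *: nsub_br x.
Proof. by apply: val_inj; rewrite [RHS]linearZ; apply: (br_skew s (val \o x)). Qed.

Fact nsub_br_filippov (i0 : 'I_n) : i0 = 0%N :> nat ->
  forall x y : 'I_n -> W, nsub_br (upd y i0 (nsub_br x)) =
    \sum_(i < n) nsub_br (upd x i (nsub_br (upd y i0 (x i)))).
Proof.
move=> hi0 x y; apply: val_inj; rewrite [RHS]raddf_sum val_nsub_upd val_nsub_br.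
rewrite br_filippov //; apply: eq_bigr => i _.
by rewrite [RHS]val_nsub_upd val_nsub_upd.
Qed.

HB.instance Definition _ := isNLieAlgebra.Build K n W
  nsub_br_linear nsub_br_skew nsub_br_filippov.

End Subalgebra.

Section Existence.
Variables (K : fieldType) (n : nat).
Implicit Type L : nLieType K n.

Lemma upper_central_family (T : Type) (H : T -> nLieType K n) L
    (p : forall t, L -> H t) (c : nat) :
  (forall t (x : 'I_n -> L), p t (br x) = br (p t \o x)) ->
  (forall t h, exists l, p t l = h) ->
  (forall t, p t 0 = 0) ->
  (forall l, (forall t, p t l = 0) -> l = 0) ->
  forall l, l \in upper_central L c <-> forall t, p t l \in upper_central (H t) c.
Proof.
move=> pbr psurj p0 pinj; elim: c => [|c IH] l.
  split=> [/eqP-> t|h]; first by rewrite p0; exact: eqxx.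
  by apply/eqP/pinj => t; apply/eqP/h.
split=> [/center_over_predP h t|h].
  apply/center_over_predP => i0 hi0 y.
  have [z hz] := choice (fun i => psurj t (y i)).
  have /IH/(_ t) := h i0 hi0 z; rewrite pbr upd_comp.
  by have -> : p t \o z = y by apply: funext.
apply/center_over_predP => i0 hi0 y; apply/IH => t; rewrite pbr upd_comp.
by have /center_over_predP/(_ i0 hi0) := h t.
Qed.

Section Pullback.
Variables (c : nat) (L : nLieType K n) (T : Type) (M : T -> nideal L).
Variables (H : T -> nLieType K n).
Variable f : forall t, {linear nquot (M t) -> nquot (upper_central (H t) c)}.
Hypothesis f_bij : forall t, bijective (f t).
Hypothesis f_br : forall t x, f t (br x) = br (f t \o x).

Definition meet_pred : {pred L} := fun u => `[< forall t, u \in M t >].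

Fact meet_submod : submod_closed meet_pred.
Proof.
split=> [|a u v /asboolP hu /asboolP hv]; apply/asboolP => t; first exact: rpred0.
by apply: rpredD; [apply: rpredZ; apply: hu|apply: hv].
Qed.

Fact meet_br (i0 : 'I_n) : i0 = 0%N :> nat ->
  forall x : 'I_n -> L, x i0 \in meet_pred -> br x \in meet_pred.
Proof.
by move=> hi0 x /asboolP h; apply/asboolP => t; apply: (nideal_br hi0); apply: h.
Qed.

Definition meet_ideal : nideal L := NIdeal meet_submod meet_br.

Definition over (h : nprod H) (l : L) :=
  forall t, npi (upper_central (H t) c) (h t) = f t (npi (M t) l).

Definition pull_pred : {pred nprod H} := fun h => `[< exists l, over h l >].

Lemma overP a h k l m : over h l -> over k m -> over (a *: h + k) (a *: l + m).
Proof.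
move=> hl km t; rewrite -[(a *: h + k) t]/(a *: h t + k t).
by rewrite npi_linear [in RHS]npi_linear linearP hl km.
Qed.

Lemma over0 : over 0 0.
Proof. by move=> t; rewrite !raddf0. Qed.

Lemma over_br (x : 'I_n -> nprod H) (y : 'I_n -> L) :
  (forall i, over (x i) (y i)) -> over (br x) (br y).
Proof.
move=> xy t; rewrite npi_br npi_br f_br; congr (nquot_br _).
by apply: funext => i /=; apply: xy.
Qed.

Fact pull_submod : submod_closed pull_pred.
Proof.
split=> [|a h k /asboolP[l hl] /asboolP[m km]]; apply/asboolP.
  by exists 0; apply: over0.
by exists (a *: l + m); apply: overP.
Qed.

Fact pull_br (x : 'I_n -> nprod H) :
  (forall i, x i \in pull_pred) -> br x \in pull_pred.
Proof.
move=> hx; have [y hy] := choice (fun i => asboolW (hx i)).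
by apply/asboolP; exists (br y); apply: over_br.
Qed.

Definition pull := nsub_of pull_submod pull_br.

Lemma pull_over (h : pull) : exists l, over (val h) l.
Proof. exact: asboolW (valP h). Qed.

Lemma pull_lift (l : L) : exists h : pull, over (val h) l.
Proof.
pose h : nprod H := fun t => nrepr (f t (npi (M t) l)).
have hl : over h l by move=> t; rewrite nreprK.
have hS : h \in pull_pred by apply/asboolP; exists l.
by exists (Sub h hS : pull); rewrite SubK.
Qed.

Lemma pull_proj t (g : H t) : exists h : pull, val h t = g.
Proof.
have [l hl] : exists l, npi _ g = f t (npi (M t) l).
  have [f' f'K fK'] := f_bij t.
  by exists (nrepr (f' (npi _ g))); rewrite nreprK fK'.
have [h hh] := pull_lift l.
pose k : nprod H := fun s =>
  if pselect (s = t) is left e then ecast z (H z) (esym e) g else val h s.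
have kl : over k l.
  move=> s; rewrite /k; case: pselect => [e|_]; last exact: hh.
  by move: g hl {k}; case: t / e.
have hS : k \in pull_pred by apply/asboolP; exists l.
exists (Sub k hS : pull); rewrite SubK /k; case: pselect => // e.
by rewrite (Prop_irrelevance e erefl).
Qed.

Lemma pull_upper_central (h : pull) l : over (val h) l ->
  h \in upper_central pull c <-> l \in meet_ideal.
Proof.
move=> hl.
rewrite (@upper_central_family T H pull (fun t (h : pull) => val h t)) //.
- split=> [hc|/asboolP lM t].
    apply/asboolP => t; apply/npi_eq0; apply: (bij_inj (f_bij t)).
    by rewrite raddf0 -hl; apply/npi_eq0.
  by apply/npi_eq0; rewrite hl -(raddf0 (f t)); congr (f t _); apply/npi_eq0.
- exact: pull_proj.
- by move=> k hk; apply: val_inj; apply: nprodP.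
Qed.

Lemma pull_capable : capable c (nquot meet_ideal).
Proof.
have [s hs] := choice pull_lift.
pose phi (q : nquot meet_ideal) : nquot (upper_central pull c) := npi _ (s (nrepr q)).
have phiE (h : pull) l : over (val h) l -> phi (npi _ l) = npi _ h.
  move=> hl; apply/npi_eq.
  have := overP (-1) hl (hs (nrepr (npi meet_ideal l))).
  rewrite !scaleN1r ![- _ + _]addrC -[val h]/(val h) => ho.
  apply/(@pull_upper_central _ (nrepr (npi meet_ideal l) - l)).
    by rewrite raddfB.
  by apply/npi_eq; rewrite nreprK.
have phi_lin : linear phi.
  move=> a u v; rewrite -[u]nreprK -[v]nreprK -npi_linear.
  have hu := hs (nrepr u); have hv := hs (nrepr v).
  rewrite (phiE _ _ hu) (phiE _ _ hv) -npi_linear; apply: phiE.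
  by rewrite linearP; apply: overP.
pose phiL := GRing.isLinear.Build _ _ _ _ phi phi_lin.
pose F : {linear nquot meet_ideal -> nquot (upper_central pull c)} :=
  HB.pack phi phiL.
exists pull, F; split; last first.
  move=> x /=; rewrite (nquot_lift x) -[br _]npi_br.
  have -> : F \o (npi meet_ideal \o (nrepr (I:=meet_ideal) \o x)) =
      npi _ \o (fun i => s (nrepr (x i))).
    by apply: funext => i /=; apply: phiE.
  rewrite -[RHS]npi_br; apply: phiE.
  by apply: over_br => i; apply: hs.
have inj_phi : injective F.
  move=> u v; rewrite -[u]nreprK -[v]nreprK => /eqP.
  rewrite -subr_eq0 -raddfB -raddfB /= => /eqP.
  have [h hh] := pull_lift (nrepr u - nrepr v).
  rewrite (phiE _ _ hh) => /npi_eq0/(pull_upper_central hh) e.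
  by apply/npi_eq.
have surj_phi q : exists p, F p = q.
  have [l hl] := pull_over (nrepr q).
  by exists (npi _ l); rewrite /= (phiE _ _ hl) nreprK.
have [g gP] := choice surj_phi.
by exists g => // u; apply: inj_phi; rewrite gP.
Qed.

End Pullback.

Lemma smallest_capable_ideal_ex (c : nat) L :
  exists M : nideal L, smallest_capable_ideal c M.
Proof.
pose T := {M : nideal L | capable c (nquot M)}.
have [H hH] := choice (fun t : T => svalP t).
pose f t := sval (cid (hH t)).
have hf t := svalP (cid (hH t)).
exists (meet_ideal (fun t : T => sval t)); split.
  by apply: (@pull_capable _ _ _ _ H f) => t; case: (hf t).
move=> M' cM' u /asboolP h; exact: (h (exist _ M' cM')).
Qed.

(* Z_c^*(L), a choice among ideals that all have the same elements
   ([smallest_capable_ideal_uniq]). *)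
Definition Zstar (c : nat) L : nideal L :=
  sval (cid (smallest_capable_ideal_ex c L)).

Lemma ZstarP (c : nat) L : smallest_capable_ideal c (Zstar c L).
Proof. exact: svalP (cid (smallest_capable_ideal_ex c L)). Qed.

Lemma smallest_capable_ideal_uniq (c : nat) L (M N : nideal L) :
  smallest_capable_ideal c M -> smallest_capable_ideal c N -> M =i N.
Proof.
by move=> [cM hM] [cN hN] u; apply/idP/idP; [apply: hM|apply: hN].
Qed.

End Existence.

(* Main.v *)
Require Import Defs.
From HB Require Import structures.
From mathcomp Require Import all_boot all_algebra.
Import GRing.Theory.
Local Open Scope ring_scope.

(** Since [Zstar c L] is the least ideal whose quotient is [c]-capable, it is
    zero exactly when the zero ideal has a [c]-capable quotient.  As the
    projection from [L] onto its quotient by the zero ideal is an isomorphism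
    ([nlie_iso_quot0]) and capability is invariant under isomorphism
    ([capable_iso]), this says that [L] itself is [c]-capable.  The argument is
    the same for every [c]; the theorem is the case [c = 2]. *)

Section Isomorphism.
Variables (K : fieldType) (n : nat).
Implicit Types L : nLieType K n.

Lemma nlie_iso_sym L1 L2 : nlie_iso L1 L2 -> nlie_iso L2 L1.
Proof.
move=> [f [[g fK gK] fbr]].
have glin : linear g.
  by move=> a u v; apply: (can_inj fK); rewrite linearP !gK.
pose gL := GRing.isLinear.Build _ _ _ _ g glin.
pose G : {linear L2 -> L1} := HB.pack g gL.
exists G; split; first by exists f.
move=> x; apply: (can_inj fK); rewrite fbr /= gK.
by congr br; apply: boolp.funext => i /=; rewrite gK.
Qed.

Lemma nlie_iso_trans L1 L2 L3 :
  nlie_iso L1 L2 -> nlie_iso L2 L3 -> nlie_iso L1 L3.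
Proof.
move=> [f [fbij fbr]] [g [gbij gbr]].
exists (g \o f : {linear L1 -> L3}); split; first exact: bij_comp gbij fbij.
by move=> x /=; rewrite fbr gbr.
Qed.

Lemma capable_iso c L1 L2 : nlie_iso L1 L2 -> capable c L1 -> capable c L2.
Proof.
move=> /nlie_iso_sym iso21 [H iso1H]; exists H.
exact: nlie_iso_trans iso21 iso1H.
Qed.

(** Ideals are compared by their elements because a record [nideal] with the
    elements of [zero_ideal L] need not be that record itself. *)
Lemma nlie_iso_quot0 L (I : nideal L) :
  I =i pred1 (0 : L) -> nlie_iso L (nquot I).
Proof.
move=> I0; exists (npi I : {linear L -> nquot I}); split; last exact: npi_br.
exists (@nrepr _ _ _ I); last exact: nreprK.
move=> u; have := nrepr_pi I u.
by rewrite I0 => /eqP/eqP; rewrite subr_eq0 => /eqP.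
Qed.

Lemma capable_Zstar0 c L : capable c L <-> Zstar c L =i pred1 (0 : L).
Proof.
have [cZ minZ] := ZstarP c L; split=> [cL u | Z0]; last first.
  exact: capable_iso (nlie_iso_sym _ _ (nlie_iso_quot0 _ _ Z0)) cZ.
have c0 : capable c (nquot (zero_ideal L)).
  by apply: capable_iso cL; apply: nlie_iso_quot0.
apply/idP/idP => [|/eqP ->]; first exact: (minZ (zero_ideal L) c0 u).
by have [] := nideal_submod (Zstar c L).
Qed.

End Isomorphism.

Theorem proposition3p1 (K : fieldType) (n : nat) (hn : (2 <= n)%N) (L : nLieType K n) :
  capable 2 L <-> Zstar 2 L =i pred1 (0 : L).
Proof. exact: capable_Zstar0. Qed.
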